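(* Let $q\ge2$ be an integer, $\beta>0$, $p=1-e^{-\beta}$, and let $\Delta$ and $C$ be constants. There is a constant $C'=C'(C,\Delta,q,\beta)$ such that for every finite bipartite graph $G=(V,\mathbb{E})$ of maximum degree at most $\Delta$: if the $q$-state Potts measure $\mu=\mu_{G,\beta}$ satisfies approximate even/odd factorization with constant $C$, then approximate spin/edge factorization holds with constant $C'$ for the Edwards-Sokal joint measure $\nu$ on $G$ with parameters $p,q$.
   Context: **Potts model.** For a finite graph $G=(V,\mathbb{E})$ let $\Omega=\{1,\dots,q\}^V$; for $\sigma\in\Omega$ let $D(\sigma)=\{\{v,w\}\in\mathbb{E}:\sigma_v\ne\sigma_w\}$, $M(\sigma)=\mathbb{E}\setminus D(\sigma)$, and $\mu(\sigma)=\frac1Z e^{-\beta|D(\sigma)|}$ with $Z$ the normalizing constant. **Joint (Edwards-Sokal) measure.** On $\Omega_J=\Omega\times\{0,1\}^{\mathbb{E}}$ (pairs $(\sigma,A)$ with $A\subseteq\mathbb{E}$), $$\nu(\sigma,A)=\frac1{Z_J}p^{|A|}(1-p)^{|\mathbb{E}|-|A|}\mathbf{1}(A\subseteq M(\sigma)),$$ with $Z_J$ the normalizing constant. Its spin marginal is $\mu$ when $p=1-e^{-\beta}$. **Entropy.** For a probability measure $\pi$ and $f\ge0$, $\mathrm{Ent}_\pi(f)=\pi[f\log(f/\pi[f])]$ (with $0\log0=0$), where $\pi[f]$ is the mean. Conditional entropies $\mathrm{Ent}_\pi(f\mid\cdot)$ are entropies with respect to the corresponding conditional measures. **Approximate even/odd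 factorization with constant $C$.** With bipartition $V=E\sqcup O$ and $\sigma_E,\sigma_O$ the restrictions of $\sigma$ to $E,O$: for all $f:\Omega\to\mathbb{R}_+$, $\mathrm{Ent}_\mu(f)\le C\big(\mu[\mathrm{Ent}_\mu(f\mid\sigma_E)]+\mu[\mathrm{Ent}_\mu(f\mid\sigma_O)]\big)$. **Approximate spin/edge factorization with constant $C'$.** For all $f:\Omega_J\to\mathbb{R}_+$, $\mathrm{Ent}_\nu(f)\le C'\big(\nu[\mathrm{Ent}_\nu(f\mid\sigma)]+\nu[\mathrm{Ent}_\nu(f\mid A)]\big)$, where $\mathrm{Ent}_\nu(f\mid\sigma)$, $\mathrm{Ent}_\nu(f\mid A)$ are the entropies of $f$ with respect to $\nu$ conditioned on the whole spin configuration being $\sigma$, respectively on the whole edge configuration being $A$. *)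

(* Defs.v *)
From HB Require Import structures.
From mathcomp Require Import all_boot all_order all_algebra.
From mathcomp Require Import reals sequences exp.
Set Implicit Arguments.
Unset Strict Implicit.
Unset Printing Implicit Defensive.
Import Order.TTheory GRing.Theory Num.Theory.
Local Open Scope ring_scope.

Section FiniteMeasure.
Variables (R : realType) (T : finType).
Implicit Types (w P f : T -> R).

Definition normalize w : T -> R := fun x => w x / \sum_y w y.

Definition mean P f : R := \sum_x P x * f x.

(* The convention 0 log 0 = 0 is automatic since the factor [f x] vanishes;   *)
(* if [mean P f = 0] then [P x * f x = 0] for every x, so Ent is 0 as well.   *)
Definition Ent P f : R := mean P (fun x => f x * ln (f x / mean P f)).

(* The conditional measure P( . | X = s). When P(X = s) = 0 division by zero  *)
(* makes this the zero function; such s do not contribute in [mean_cond_Ent]. *)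
Definition cond (S : eqType) P (X : T -> S) (s : S) : T -> R :=
  fun x => if X x == s then P x / \sum_(y | X y == s) P y else 0.

Definition cond_Ent (S : eqType) P f (X : T -> S) : T -> R :=
  fun x => Ent (cond P X (X x)) f.

Definition mean_cond_Ent (S : eqType) P f (X : T -> S) : R :=
  mean P (cond_Ent P f X).

End FiniteMeasure.

Section Graph.
Variables (V : finType) (e : rel V).

Definition simple_graph : Prop := symmetric e /\ irreflexive e.

Definition max_degree : nat := (\max_(v : V) #|[set w | e v w]|)%N.

Definition bipartition (E O : {set V}) : Prop :=
  [/\ E :|: O = [set: V], [disjoint E & O]
    & forall v w, e v w -> (v \in E) = (w \in O)].

Definition edge_set : {set {set V}} :=
  [set x | [exists v, exists w, e v w && (x == [set v; w])]].

Definition edge : finType := {x : {set V} | x \in edge_set}.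

End Graph.

Section Potts.
Variables (R : realType) (q : nat) (V : finType) (e : rel V).

(* The spins {1, ..., q} are indexed by 'I_q = {0, ..., q-1}. *)
Definition spin_config (W : finType) : finType := {ffun W -> 'I_q}.

Definition edge_config : finType := {set edge e}.

Definition joint_config : finType := (spin_config V * edge_config)%type.

Definition D (sigma : spin_config V) : {set edge e} :=
  [set x : edge e |
    [exists v in val x, exists w in val x, sigma v != sigma w]].

Definition M (sigma : spin_config V) : {set edge e} := ~: D sigma.

Definition restrict (B : {set V}) (sigma : spin_config V) :
    spin_config {v : V | v \in B} :=
  [ffun v => sigma (val v)].

Definition potts (beta : R) : spin_config V -> R :=
  normalize (fun sigma => expR (- (beta * #|D sigma|%:R))).

Definition edwards_sokal (p : R) : joint_config -> R :=
  normalize (fun sA : joint_config =>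
    p ^+ #|sA.2| * (1 - p) ^+ (#|edge e| - #|sA.2|)
    * (sA.2 \subset M sA.1)%:R).

Definition even_odd_factorization
    (mu : spin_config V -> R) (E O : {set V}) (C : R) : Prop :=
  forall f : spin_config V -> R, (forall sigma, 0 <= f sigma) ->
    Ent mu f <=
      C * (mean_cond_Ent mu f (restrict E) + mean_cond_Ent mu f (restrict O)).

Definition spin_edge_factorization (nu : joint_config -> R) (C' : R) : Prop :=
  forall f : joint_config -> R, (forall sA, 0 <= f sA) ->
    Ent nu f <=
      C' * (mean_cond_Ent nu f (fun sA : joint_config => sA.1)
            + mean_cond_Ent nu f (fun sA : joint_config => sA.2)).

End Potts.

Arguments potts {R} q {V} e beta.
Arguments edwards_sokal {R} q {V} e p.

(* Main.v *)
(* Write F = nu f and let rent X be the relative entropy of the law of X under F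
   with respect to its law under nu. Then Ent f = rent id - rent 1 and
   nu[Ent(f | X)] = rent id - rent X, so everything is a linear inequality between
   relative entropies of marginals.

   Applying the even/odd factorization to nu[f | sigma] reduces the claim to
   rent sigma - rent sigma_E <= c ((rent id - rent sigma) + (rent id - rent A)),
   and the same with O. Given sigma_E, nu is a product over the vertices v of O of
   measures of (sigma_v, A_v), where A_v is the set of open edges at v. For one
   factor, A_v is empty with probability bounded below whatever sigma_v is, and a
   comparison of square roots of densities (Hellinger distance) on that event gives
   the spin/edge factorization with a constant depending on q, beta, Delta only.
   The factors are then added one at a time, using that conditional independence
   under nu makes rent supermodular. *)
Require Import Defs.
From mathcomp Require Import all_boot all_order all_algebra.
From mathcomp Require Import reals sequences exp.
From mathcomp Require Import ring lra.
Set Implicit Arguments.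
Unset Strict Implicit.
Unset Printing Implicit Defensive.
Import Order.TTheory GRing.Theory Num.Theory.
Local Open Scope ring_scope.

(** * Logarithm and square-root inequalities *)

Lemma ln_ge1BV (R : realType) (x : R) : 0 < x -> 1 - x^-1 <= ln x.
Proof.
move=> x0; have y0 : 0 < x^-1 by rewrite invr_gt0.
have := @le_ln1Dx R (x^-1 - 1); rewrite [1 + _]addrC subrK lnV ?posrE//.
by move=> /(_ ltac:(lra)); lra.
Qed.

(** The left side is [2a - 2 sqrt(ab)], which is what [ln u >= 1 - 1/u] at [u = sqrt(a) / sqrt(b)]
    gives after multiplication by [2a]. *)
Lemma sqrB_sqrt_le (R : realType) (a b : R) :
  0 <= a -> 0 <= b -> (b = 0 -> a = 0) ->
  a - b + (Num.sqrt a - Num.sqrt b) ^+ 2 <= a * ln (a / b).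
Proof.
move=> a0 b0 ba; have [->|an0] := eqVneq a 0.
  by rewrite sqrtr0 !sub0r sqrrN sqr_sqrtr// mul0r addNr.
have bn0 : b != 0 by apply: contra_neq an0.
have t0 : 0 < Num.sqrt a by rewrite sqrtr_gt0 lt_def an0.
have s0 : 0 < Num.sqrt b by rewrite sqrtr_gt0 lt_def bn0.
have := sqr_sqrtr a0; have := sqr_sqrtr b0; move: t0 s0.
set t := Num.sqrt a; set s := Num.sqrt b => t0 s0 <- <-.
have ts0 : 0 < t / s by rewrite divr_gt0.
have -> : t ^+ 2 / s ^+ 2 = (t / s) ^+ 2 by rewrite expr_div_n.
rewrite lnXn// -mulr_natr.
have := ln_ge1BV ts0; rewrite invf_div => h.
have := ler_wpM2l (sqr_ge0 t) h.
rewrite mulrBr mulr1 mulrCA -[t ^+ 2 / t]/(t * t / t) mulfK ?gt_eqF//; nra.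
Qed.

(** * Relative entropies of laws of functions on a finite space *)

Section RelativeEntropy.
Variables (R : realType) (T : finType).
Implicit Types (P F f g : T -> R) (K : eqType).

(** Evaluated at a point rather than at a value of [X], so that marginals of variables with
    different codomains are all functions on [T]. *)
Definition mass P K (X : T -> K) (x : T) : R := \sum_(y | X y == X x) P y.

Definition dens P F K (X : T -> K) (x : T) : R := mass F X x / mass P X x.

(* The relative entropy of the law of X under F with respect to its law under
   P, when F is absolutely continuous with respect to P. *)
Definition rent P F K (X : T -> K) : R := \sum_x F x * ln (dens P F X x).

Definition refines K1 K2 (X : T -> K1) (Y : T -> K2) :=
  forall x y, X x = X y -> Y x = Y y.

Lemma mass_ext P K1 K2 (X : T -> K1) (Y : T -> K2) :
  refines X Y -> refines Y X -> mass P X =1 mass P Y.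
Proof.
by move=> XY YX x; apply: eq_bigl => y; apply/eqP/eqP => [/XY|/YX].
Qed.

Lemma rent_ext P F K1 K2 (X : T -> K1) (Y : T -> K2) :
  refines X Y -> refines Y X -> rent P F X = rent P F Y.
Proof.
by move=> XY YX; apply: eq_bigr => x _; rewrite /dens !(mass_ext _ XY YX).
Qed.

Lemma mass_ge0 P K (X : T -> K) x : (forall y, 0 <= P y) -> 0 <= mass P X x.
Proof. by move=> P0; apply: sumr_ge0. Qed.

Lemma ler_mass P K (X : T -> K) x : (forall y, 0 <= P y) -> P x <= mass P X x.
Proof.
by move=> P0; rewrite /mass (bigD1 x)//= lerDl sumr_ge0.
Qed.

Lemma mass_congr P K (X : T -> K) x y : X x = X y -> mass P X x = mass P X y.
Proof. by move=> e; rewrite /mass e. Qed.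

Lemma mass_refines P K1 K2 (X : T -> K1) (Y : T -> K2) x :
  (forall y, 0 <= P y) -> refines X Y -> mass P X x <= mass P Y x.
Proof.
move=> P0 XY; rewrite /mass [leRHS](bigID (fun y => X y == X x))/=.
rewrite [X in _ <= X + _](eq_bigl (fun y => X y == X x)) ?lerDl ?sumr_ge0// => y.
by rewrite andb_idl// => /eqP/XY ->.
Qed.

Lemma mass_le P P' K (X : T -> K) x :
  (forall y, P y <= P' y) -> mass P X x <= mass P' X x.
Proof. by move=> PP'; apply: ler_sum. Qed.

Lemma dens_congr P F K1 K2 (X : T -> K1) (Y : T -> K2) :
  refines X Y -> forall x y, X x = X y -> dens P F Y x = dens P F Y y.
Proof. by move=> XY x y /XY e; rewrite /dens !(mass_congr _ e). Qed.

(** [dens P F X] is the conditional expectation given [X] of the density of [F], so pairing it with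
    an [X]-measurable [g] does not see the conditioning. *)
Lemma sum_dens P F K (X : T -> K) g :
  (forall x, 0 <= P x) -> (forall x, P x = 0 -> F x = 0) ->
  (forall x y, X x = X y -> g x = g y) ->
  \sum_x P x * (dens P F X x * g x) = \sum_x F x * g x.
Proof.
move=> P0 PF gX.
transitivity (\sum_x \sum_y (X y == X x)%:R * (P x / mass P X y * (F y * g y))).
  apply: eq_bigr => x _.
  rewrite /dens {1}/mass mulr_suml mulr_suml mulr_sumr big_mkcond/=.
  apply: eq_bigr => y _; case: eqP => [e|_]; rewrite ?mulr1n ?mulr0n ?mul0r//.
  by rewrite mul1r (gX _ _ e) (mass_congr _ e); ring.
rewrite exchange_big/=; apply: eq_bigr => y _.
have [Fy|Fy] := eqVneq (F y) 0.
  by rewrite Fy mul0r big1// => x _; rewrite !mulr0.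
transitivity ((\sum_(x | X x == X y) P x) / mass P X y * (F y * g y)).
  rewrite !mulr_suml [RHS]big_mkcond/=; apply: eq_bigr => x _.
  by rewrite eq_sym; case: eqP => _; rewrite ?mulr1n ?mulr0n ?mul1r ?mul0r.
rewrite divff ?mul1r// gt_eqF//.
apply: (lt_le_trans _ (ler_mass X y P0)); rewrite lt_def P0 andbT.
by apply: contra_neq Fy => /PF.
Qed.

Section AbsolutelyContinuous.
Variables (P F : T -> R).
Hypotheses (P0 : forall x, 0 <= P x) (F0 : forall x, 0 <= F x).
Hypothesis PF : forall x, P x = 0 -> F x = 0.

Let gt0P x : F x != 0 -> 0 < P x.
Proof. by move=> Fx; rewrite lt_def P0 andbT; apply: contra_neq Fx => /PF. Qed.

Let gt0F x : F x != 0 -> 0 < F x.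
Proof. by move=> Fx; rewrite lt_def F0 Fx. Qed.

Let massP_gt0 K (X : T -> K) x : 0 < P x -> 0 < mass P X x.
Proof. by move=> Px; apply: lt_le_trans (ler_mass X x P0). Qed.

Let massF_gt0 K (X : T -> K) x : 0 < F x -> 0 < mass F X x.
Proof. by move=> Fx; apply: lt_le_trans (ler_mass X x F0). Qed.

Lemma dens_ge0 K (X : T -> K) x : 0 <= dens P F X x.
Proof. by rewrite divr_ge0// mass_ge0. Qed.

Lemma dens_gt0 K (X : T -> K) x : F x != 0 -> 0 < dens P F X x.
Proof.
by move=> Fx; rewrite divr_gt0//; [apply/massF_gt0/gt0F|apply/massP_gt0/gt0P].
Qed.

Lemma dens_eq0_refines K1 K2 (X : T -> K1) (Y : T -> K2) x :
  refines X Y -> 0 < P x -> dens P F Y x = 0 -> dens P F X x = 0.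
Proof.
move=> XY Px /eqP; rewrite mulf_eq0 invr_eq0 (gt_eqF (massP_gt0 Y Px)) orbF.
move=> /eqP FY; rewrite /dens.
suff -> : mass F X x = 0 by rewrite mul0r.
by apply/le_anti; rewrite mass_ge0// andbT -FY mass_refines.
Qed.

Lemma sum_dens1 K (X : T -> K) : \sum_x P x * dens P F X x = \sum_x F x.
Proof.
have := @sum_dens P F K X (fun=> 1) P0 PF (fun _ _ _ => erefl).
by under eq_bigr do rewrite mulr1; under [RHS]eq_bigr do rewrite mulr1.
Qed.

Lemma rent_sub K1 K2 (X : T -> K1) (Y : T -> K2) :
  rent P F X - rent P F Y = \sum_x F x * ln (dens P F X x / dens P F Y x).
Proof.
rewrite /rent -sumrB; apply: eq_bigr => x _.
have [->|Fx] := eqVneq (F x) 0; first by rewrite !mul0r subrr.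
by rewrite -mulrBr ln_div// posrE dens_gt0.
Qed.

(** [sqrB_sqrt_le] is summed against [P]; its linear part vanishes because both densities have
    [P]-integral [\sum_x F x]. *)
Lemma rent_hellinger K1 K2 (X : T -> K1) (Y : T -> K2) : refines X Y ->
  \sum_x P x * (Num.sqrt (dens P F X x) - Num.sqrt (dens P F Y x)) ^+ 2
    <= rent P F X - rent P F Y.
Proof.
move=> XY; rewrite rent_sub.
rewrite -(@sum_dens P F K1 X (fun x => ln (dens P F X x / dens P F Y x)))//;
  last first.
  move=> x y e.
  by rewrite (dens_congr P F XY e) (dens_congr P F (X := X) _ e).
have e0 : \sum_x P x * (dens P F X x - dens P F Y x) = 0.
  by under eq_bigr do rewrite mulrBr; rewrite sumrB !sum_dens1 subrr.
rewrite -[leLHS]add0r -[X in X + _]e0 -big_split/=; apply: ler_sum => x _.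
rewrite -mulrDr; have [->|Px] := eqVneq (P x) 0; first by rewrite !mul0r.
apply: ler_wpM2l => //; apply: sqrB_sqrt_le; rewrite ?dens_ge0//.
by apply: dens_eq0_refines => //; rewrite lt_def Px P0.
Qed.

Lemma rent_le K1 K2 (X : T -> K1) (Y : T -> K2) : refines X Y ->
  rent P F Y <= rent P F X.
Proof.
move=> XY; rewrite -subr_ge0; apply: le_trans (rent_hellinger XY).
by apply: sumr_ge0 => x _; rewrite mulr_ge0// sqr_ge0.
Qed.

(* After ln t >= 1 - 1/t, the double sum left to bound runs over pairs of an
   X1-class and an X2-class inside a common Z-class, and each such pair meets in
   at most one X12-class. *)
Lemma rent_supermodular K K1 K2 K12
    (Z : T -> K) (X1 : T -> K1) (X2 : T -> K2) (X12 : T -> K12) :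
  refines X1 Z -> refines X2 Z -> refines X12 X1 -> refines X12 X2 ->
  (forall x y, X1 x = X1 y -> X2 x = X2 y -> X12 x = X12 y) ->
  (forall x, mass P X1 x * mass P X2 x = mass P X12 x * mass P Z x) ->
  rent P F X1 + rent P F X2 <= rent P F X12 + rent P F Z.
Proof.
move=> X1Z X2Z X121 X122 X12i PP.
(* Where [F x] is nonzero, [r x] is the ratio of densities X1 X2 / (X12 Z): the product hypothesis
   cancels the [P]-masses. *)
pose r x := mass F X1 x * mass F X2 x / (mass F X12 x * mass F Z x).
have step : \sum_x F x * (1 - r x)
    <= rent P F X12 + rent P F Z - (rent P F X1 + rent P F X2).
  rewrite /rent -!big_split/= -sumrB; apply: ler_sum => x _.
  have [->|Fx] := eqVneq (F x) 0; first by rewrite !mul0r !addr0 subrr.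
  have Px := gt0P Fx; have Fx0 := gt0F Fx.
  have d0 K' (X : T -> K') : dens P F X x \in Num.pos by rewrite posrE dens_gt0.
  rewrite -!mulrDr -mulrBr ler_wpM2l// -!lnM// -ln_div; last 2 first.
  - by apply: mulr_gt0; rewrite -posrE.
  - by apply: mulr_gt0; rewrite -posrE.
  suff -> : dens P F X12 x * dens P F Z x / (dens P F X1 x * dens P F X2 x)
      = (r x)^-1.
    rewrite -[X in 1 - X]invrK; apply: ln_ge1BV.
    by rewrite invr_gt0 divr_gt0// mulr_gt0// massF_gt0.
  rewrite /r /dens !invfM !invrK.
  have m1 := massP_gt0 X1 Px; have m2 := massP_gt0 X2 Px.
  have m12 := massP_gt0 X12 Px; have mz := massP_gt0 Z Px.
  transitivity (mass F X12 x * mass F Z x / (mass F X1 x * mass F X2 x) *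
    (mass P X1 x * mass P X2 x / (mass P X12 x * mass P Z x))).
    by rewrite !invfM; ring.
  rewrite PP divff; last by rewrite gt_eqF// mulr_gt0.
  by rewrite mulr1 !invfM mulrC.
rewrite -subr_ge0; apply: le_trans step.
under eq_bigr do rewrite mulrBr mulr1.
rewrite sumrB subr_ge0.
have -> : \sum_x F x * r x = \sum_u \sum_v \sum_(x | (X1 u == X1 x) && (X2 v == X2 x))
    F u * F v * (F x / (mass F X12 x * mass F Z x)).
  transitivity (\sum_x \sum_(u | X1 u == X1 x) \sum_(v | X2 v == X2 x)
      F u * F v * (F x / (mass F X12 x * mass F Z x))).
    apply: eq_bigr => x _; rewrite /r mulrCA mulrA {1}/mass.
    rewrite big_distrlr/= mulr_suml mulr_suml; apply: eq_bigr => u _.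
    by rewrite !mulr_suml; apply: eq_bigr => v _; rewrite !mulrA.
  under eq_bigr do rewrite big_mkcond/=.
  rewrite exchange_big/=; apply: eq_bigr => u _.
  transitivity (\sum_x \sum_v if (X1 u == X1 x) && (X2 v == X2 x) then
      F u * F v * (F x / (mass F X12 x * mass F Z x)) else 0).
    apply: eq_bigr => x _; case: eqP => _; last by rewrite big1.
    by rewrite big_mkcond.
  by rewrite exchange_big/=; apply: eq_bigr => v _; rewrite [RHS]big_mkcond.
apply: ler_sum => u _.
have [Fu|Fu] := eqVneq (F u) 0.
  rewrite {2}Fu big1// => v _; rewrite big1// => x _; by rewrite Fu !mul0r.
have mZ : 0 < mass F Z u by apply/massF_gt0/gt0F.
(* Inserting [mass F Z u / mass F Z u] turns the bound into a sum over [v] in the [Z]-class of [u],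
   compared term by term. *)
rewrite -[leRHS]mulr1 -(divff (lt0r_neq0 mZ)) {2}/mass mulr_suml mulr_sumr.
rewrite [leRHS]big_mkcond/=; apply: ler_sum => v _.
case: (pickP (fun x => (X1 u == X1 x) && (X2 v == X2 x))) => [x|none]; last first.
  rewrite big_pred0//; case: ifP => // _.
  by rewrite mulr_ge0// divr_ge0// mass_ge0.
move=> /andP[/eqP ux /eqP vx].
have zvu : Z v = Z u by rewrite (X2Z _ _ vx) (X1Z _ _ ux).
rewrite zvu eqxx.
have -> : \sum_(x0 | (X1 u == X1 x0) && (X2 v == X2 x0))
     F u * F v * (F x0 / (mass F X12 x0 * mass F Z x0)) =
   F u * (F v / mass F Z u) * (mass F X12 x / mass F X12 x).
  rewrite {3}/mass mulrA mulr_sumr mulr_suml; apply: eq_big => y.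
    apply/andP/eqP => [[/eqP uy /eqP vy]|yx].
      by apply: X12i; [rewrite -uy|rewrite -vy].
    by rewrite ux vx (X121 _ _ yx) (X122 _ _ yx).
  move=> /andP[/eqP uy /eqP vy].
  have yx : X12 y = X12 x by apply: X12i; [rewrite -uy|rewrite -vy].
  rewrite (mass_congr _ yx) -(mass_congr _ (X1Z _ _ uy)) invfM; ring.
rewrite -[leRHS]mulr1; apply: ler_wpM2l; first by rewrite mulr_ge0// divr_ge0// mass_ge0.
(* A class of zero [F]-mass contributes 0 / 0 = 0, still at most 1. *)
have [->|m0] := eqVneq (mass F X12 x) 0; first by rewrite mul0r ler01.
by rewrite divff.
Qed.

End AbsolutelyContinuous.
End RelativeEntropy.

(** * Factorization for a single block *)

Lemma ler_lnB1 (R : realType) (x : R) : 0 < x -> ln x <= x - 1.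
Proof.
by move=> x0; rewrite -[x in ln x](subrK 1) addrC; apply: le_ln1Dx; lra.
Qed.

(** Turns a chi-square term into a Hellinger term: factor [a - b] through square roots and use
    [(sqrt a + sqrt b)^2 <= 2(a + b) <= 4z/d]. *)
Lemma sqrB_div_le (R : realType) (a b z d : R) :
  0 < d -> 0 <= a -> 0 <= b -> 0 <= z -> d * a <= z -> d * b <= z ->
  (a - b) ^+ 2 / z <= 4 / d * (Num.sqrt a - Num.sqrt b) ^+ 2.
Proof.
move=> d0 a0 b0 z0 az bz; have [->|zn0] := eqVneq z 0.
  by rewrite invr0 mulr0 mulr_ge0 ?sqr_ge0// divr_ge0// ltW.
have {zn0}zgt0 : 0 < z by rewrite lt_def zn0.
rewrite ler_pdivrMr// -(ler_pM2l d0).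
have -> u : d * (4 / d * u * z) = 4 * u * z by field; rewrite gt_eqF.
move: az bz; have := sqr_sqrtr a0; have := sqr_sqrtr b0.
set t := Num.sqrt a; set s := Num.sqrt b => <- <- tz sz.
have -> : d * (t ^+ 2 - s ^+ 2) ^+ 2 = (t - s) ^+ 2 * (d * (t + s) ^+ 2) by ring.
rewrite [leRHS](_ : _ = (t - s) ^+ 2 * (4 * z)); last by ring.
apply: ler_wpM2l; first exact: sqr_ge0.
have : 0 <= d * (t - s) ^+ 2 by rewrite mulr_ge0 ?sqr_ge0 ?ltW.
nra.
Qed.

Section Local.
Variables (R : realType) (T : finType) (P F : T -> R).
Hypotheses (P0 : forall x, 0 <= P x) (F0 : forall x, 0 <= F x).
Hypothesis PF : forall x, P x = 0 -> F x = 0.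

(** [ln t <= t - 1] gives the bound centred at [dens P F Z]. A conditional mean minimizes squared
    deviation, so another [Z]-measurable centre [c] only adds the nonnegative term
    [(z - c)^2 / z]. *)
Lemma rent_sub_le_chi2 (K K1 : eqType) (Z : T -> K) (X : T -> K1) (c : T -> R) :
  refines X Z -> (forall x y, Z x = Z y -> c x = c y) ->
  rent P F X - rent P F Z
    <= \sum_x P x * ((dens P F X x - c x) ^+ 2 / dens P F Z x).
Proof.
move=> XZ cZ; set f := dens P F X; set z := dens P F Z.
have fX x y : X x = X y -> f x = f y by apply: dens_congr.
have zZ x y : Z x = Z y -> z x = z y by apply: dens_congr.
apply: (@le_trans _ _ (\sum_x P x * (f x * (f x / z x - 1)))).
  rewrite sum_dens//; last first.
    by move=> x y e; rewrite (fX _ _ e) (zZ _ _ (XZ _ _ e)).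
  rewrite rent_sub//; apply: ler_sum => x _.
  have [->|Fx] := eqVneq (F x) 0; first by rewrite !mul0r.
  by apply: ler_wpM2l => //; apply: ler_lnB1; rewrite divr_gt0 ?dens_gt0.
(* Being [Z]-measurable, [g] pairs equally with [f] and with its conditional mean [z]. *)
pose g x := 1 - 2 * c x / z x.
have gZ x y : Z x = Z y -> g x = g y by move=> e; rewrite /g (cZ _ _ e) (zZ _ _ e).
have h : \sum_x P x * (f x * g x) = \sum_x P x * (z x * g x).
  by rewrite !sum_dens// => x y /XZ/gZ.
rewrite -subr_ge0 -sumrB.
have -> : \sum_x (P x * ((f x - c x) ^+ 2 / z x) - P x * (f x * (f x / z x - 1)))
    = \sum_x P x * (f x * g x) + \sum_x P x * (c x ^+ 2 / z x).
  by rewrite -big_split; apply: eq_bigr => x _; rewrite /g/=; ring.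
rewrite h -big_split; apply: sumr_ge0 => x _ /=.
rewrite -mulrDr mulr_ge0// /g; have [->|zn0] := eqVneq (z x) 0.
  by rewrite invr0 !mulr0 mul0r addr0.
have -> : z x * (1 - 2 * c x / z x) + c x ^+ 2 / z x = (z x - c x) ^+ 2 / z x.
  by field.
by rewrite divr_ge0 ?sqr_ge0 ?dens_ge0.
Qed.

(* On the event N, X2 carries no more information than Z, so the density given X2
   is there a Z-measurable centre for the chi-square bound on rent X1 - rent Z.
   The bound localizes to N because N has conditional probability at least d
   given X1, and there the square root densities are compared through those of
   X12. *)
Lemma rent_two_block (K K1 K2 K12 : eqType)
    (Z : T -> K) (X1 : T -> K1) (X2 : T -> K2) (X12 : T -> K12)
    (N : pred T) (d : R) :
  0 < d ->
  refines X1 Z -> refines X2 Z -> refines X12 X1 -> refines X12 X2 ->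
  (forall x y, X2 x = X2 y -> N x = N y) ->
  (forall x y, N x -> N y -> Z x = Z y -> X2 x = X2 y) ->
  (forall x, d * mass P Z x <= mass (fun y => P y * (N y)%:R) X1 x) ->
  rent P F X12 - rent P F Z <= (1 + 8 / d ^+ 2) *
    ((rent P F X12 - rent P F X1) + (rent P F X12 - rent P F X2)).
Proof.
move=> d0 X1Z X2Z X121 X122 X2N NZ dP.
set f1 := dens P F X1; set fZ := dens P F Z.
set f2 := dens P F X2; set f12 := dens P F X12.
pose PN x := P x * (N x)%:R; pose FN x := F x * (N x)%:R.
have PN0 x : 0 <= PN x by rewrite mulr_ge0.
have PNP x : PN x <= P x by rewrite ler_piMr// lern1 leq_b1.
(* The density of [Z] for the measures restricted to [N]: [Z]-measurable everywhere, and equal to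
   [f2] on [N]. *)
pose c := dens PN FN Z.
have cZ x y : Z x = Z y -> c x = c y by apply: dens_congr.
have massN (G : T -> R) x : N x -> mass (fun y => G y * (N y)%:R) Z x = mass G X2 x.
  move=> Nx; rewrite /mass [RHS]big_mkcond [LHS]big_mkcond/=; apply: eq_bigr => y _.
  case: (boolP (N y)) => [Ny|Ny].
    have -> : (Z y == Z x) = (X2 y == X2 x).
      by apply/eqP/eqP => [/(NZ _ _ Ny Nx)|/X2Z].
    by rewrite mulr1.
  rewrite mulr0 if_same; case: eqP => // /X2N e.
  by rewrite e Nx in Ny.
have c2 x : N x -> c x = f2 x by move=> Nx; rewrite /c /f2 /dens !massN.
pose g x := (f1 x - c x) ^+ 2 / fZ x.
have g0 x : 0 <= g x by rewrite divr_ge0 ?sqr_ge0// dens_ge0.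
have gX1 x y : X1 x = X1 y -> g x = g y.
  move=> e; have e' := X1Z _ _ e; rewrite /g (cZ _ _ e').
  by rewrite /f1 /fZ (dens_congr P F X1Z e) (dens_congr P F (X:=X1) (Y:=X1) _ e).
(* [dens P PN X1] is the conditional probability of [N] given [X1], and [g] is [X1]-measurable. *)
have dg : d * \sum_x P x * g x <= \sum_x PN x * g x.
  rewrite -(@sum_dens _ _ P PN _ X1 g)//; last first.
    by move=> x Px; rewrite /PN Px mul0r.
  rewrite mulr_sumr; apply: ler_sum => x _.
  have [->|Px] := eqVneq (P x) 0; first by rewrite !mul0r mulr0.
  rewrite mulrCA ler_wpM2l// ler_wpM2r//.
  have mP : 0 < mass P X1 x.
    by apply: lt_le_trans (ler_mass X1 x P0); rewrite lt_def Px P0.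
  rewrite ler_pdivlMr//; apply: le_trans (dP x).
  by rewrite ler_pM2l// mass_refines.
have gN x : PN x * g x <= 8 / d *
    (P x * (Num.sqrt (f12 x) - Num.sqrt (f1 x)) ^+ 2 +
     P x * (Num.sqrt (f12 x) - Num.sqrt (f2 x)) ^+ 2).
  rewrite -mulrDr.
  have S0 : 0 <= 8 / d * (P x * ((Num.sqrt (f12 x) - Num.sqrt (f1 x)) ^+ 2 +
       (Num.sqrt (f12 x) - Num.sqrt (f2 x)) ^+ 2)).
    by rewrite mulr_ge0 ?divr_ge0 ?mulr_ge0 ?addr_ge0 ?sqr_ge0// ltW.
  rewrite /PN; case: (boolP (N x)) => Nx; last by rewrite mulr0 mul0r.
  have [Px|Px] := eqVneq (P x) 0; first by rewrite {1}Px !mul0r.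
  have Pgt0 : 0 < P x by rewrite lt_def Px P0.
  rewrite mulr1 [leRHS]mulrCA ler_wpM2l//.
  have PZ : 0 < mass P Z x by apply: lt_le_trans (ler_mass Z x P0).
  (* The [F]-mass of a class is at most that of its [Z]-class, so a class holding a fraction [d] of
     the [P]-mass has density at most [fZ / d]. *)
  have bound (K' : eqType) (X : T -> K') : refines X Z -> d * mass P Z x <= mass P X x ->
      d * dens P F X x <= fZ x.
    move=> XZ dPX; have PX : 0 < mass P X x by apply: lt_le_trans dPX; exact: mulr_gt0.
    rewrite /fZ /dens mulrA ler_pdivrMr// mulrAC ler_pdivlMr//.
    rewrite mulrAC [leLHS]mulrC; apply: ler_pM; rewrite ?mass_ge0 ?mulr_ge0 ?mass_ge0 ?(ltW d0)//.
      exact: mass_refines.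
  have b1 : d * f1 x <= fZ x.
    by apply: bound => //; apply: le_trans (dP x) _; apply: mass_le.
  have b2 : d * f2 x <= fZ x.
    apply: bound => //; apply: le_trans (dP x) _; rewrite -(massN P)//.
    exact: mass_refines.
  rewrite /g c2//; apply: le_trans (sqrB_div_le d0 _ _ _ b1 b2) _; rewrite ?dens_ge0//.
  set s1 := Num.sqrt _; set s2 := Num.sqrt _; set s := Num.sqrt _.
  have -> : 8 / d = 4 / d * 2 by field; rewrite gt_eqF.
  rewrite -[leRHS]mulrA; apply: ler_wpM2l; first by rewrite divr_ge0 ?ltW.
  (* [(s1 - s2)^2 <= 2 (s - s1)^2 + 2 (s - s2)^2], the difference being this square. *)
  have := sqr_ge0 (s1 + s2 - 2 * s); nra.
have h1 := rent_hellinger P0 F0 PF X121.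
have h2 := rent_hellinger P0 F0 PF X122.
have h : rent P F X1 - rent P F Z <= 8 / d ^+ 2 *
    ((rent P F X12 - rent P F X1) + (rent P F X12 - rent P F X2)).
  apply: le_trans (rent_sub_le_chi2 X1Z cZ) _.
  rewrite -(ler_pM2l d0); apply: le_trans dg _.
  apply: le_trans (ler_sum _ (fun x _ => gN x)) _.
  rewrite -mulr_sumr big_split/=.
  have -> : d * (8 / d ^+ 2 * (rent P F X12 - rent P F X1 + (rent P F X12 - rent P F X2)))
    = 8 / d * (rent P F X12 - rent P F X1 + (rent P F X12 - rent P F X2)).
    by field; rewrite gt_eqF.
  by rewrite ler_wpM2l ?divr_ge0 ?lerD// ltW.
(* The summand 1 of the constant pays for passing from [X12] to [X1]; the other difference is
   nonnegative. *)
have h12 := rent_le P0 F0 PF X122.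
rewrite mulrDl mul1r; lra.
Qed.

End Local.

(** * Conditional entropy as a difference of relative entropies *)

Section EntropyAsRelativeEntropy.
Variables (R : realType) (T : finType) (P f : T -> R).
Hypotheses (P0 : forall x, 0 <= P x) (f0 : forall x, 0 <= f x).
Let F x := P x * f x.

(** The conditional mean of [f] given [X] is [dens P F X], and [f] is [dens P F id] wherever [P] is
    nonzero; averaging leaves the [F]-mean of the log of their ratio. *)
Lemma mean_cond_EntE (S : eqType) (X : T -> S) :
  mean_cond_Ent P f X = rent P F id - rent P F X.
Proof.
have F0 x : 0 <= F x by rewrite mulr_ge0.
have PF x : P x = 0 -> F x = 0 by rewrite /F => ->; rewrite mul0r.
have meanE x : mean (cond P X (X x)) f = dens P F X x.
  rewrite /mean /dens {1}/mass mulr_suml [RHS]big_mkcond; apply: eq_bigr => y _.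
  by rewrite /cond; case: eqP => _; rewrite ?mul0r// mulrAC.
pose h y := f y * ln (f y / dens P F X y).
transitivity (\sum_x P x * dens P (fun y => P y * h y) X x).
  apply: eq_bigr => x _; congr (_ * _).
  rewrite /cond_Ent /Ent meanE /mean [RHS]mulr_suml [RHS]big_mkcond.
  apply: eq_bigr => y _; rewrite /cond; case: eqP => [e|_]; rewrite ?mul0r//.
  by rewrite mulrAC /h /dens !(mass_congr _ e).
rewrite sum_dens1//; last by move=> x ->; rewrite mul0r.
rewrite rent_sub//; apply: eq_bigr => x _; rewrite /h /F mulrA.
have [->|Px] := eqVneq (P x) 0; first by rewrite !mul0r.
rewrite [dens P F id x](_ : _ = f x)// /dens /mass !big_pred1_eq /F.
by rewrite mulrAC divff// mul1r.
Qed.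

Lemma EntE : \sum_x P x = 1 ->
  Ent P f = rent P F id - rent P F (fun=> tt).
Proof.
move=> P1; rewrite -mean_cond_EntE /mean_cond_Ent /cond_Ent /mean.
rewrite -mulr_suml P1 mul1r /Ent.
have condE x : cond P (fun=> tt) tt x = P x by rewrite /cond eqxx P1 divr1.
have -> : mean (cond P (fun=> tt) tt) f = mean P f.
  by apply: eq_bigr => x _; rewrite condE.
by apply: eq_bigr => x _; rewrite condE.
Qed.

End EntropyAsRelativeEntropy.

Lemma mass_marginal (R : realType) (T1 T2 : finType) (P : T1 * T2 -> R)
    (K : eqType) (X : T1 -> K) (x : T1 * T2) :
  mass (fun s => \sum_a P (s, a)) X x.1 = mass P (X \o fst) x.
Proof.
rewrite /mass (pair_big (fun s => X s == X x.1) xpredT)/=.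
by apply: eq_big => [|[]//] y; rewrite andbT.
Qed.

(** Lets the even/odd hypothesis on the spin marginal be read as an inequality for the joint
    measure. *)
Lemma rent_marginal (R : realType) (T1 T2 : finType) (P F : T1 * T2 -> R)
    (K : eqType) (X : T1 -> K) :
  rent (fun s => \sum_a P (s, a)) (fun s => \sum_a F (s, a)) X
    = rent P F (X \o fst).
Proof.
rewrite /rent; under eq_bigr do rewrite mulr_suml.
rewrite pair_bigA/=; apply: eq_bigr => -[s a] _ /=.
by rewrite /dens -!mass_marginal.
Qed.

(** * Partial views, gluing and weights of joint configurations *)

Section JointModel.
Variables (R : realType) (q : nat) (V : finType) (e : rel V).
Local Notation T := (joint_config q e).
Implicit Types (s t : T) (U S : {set V}) (W : {set edge e}).

Lemma edge_endpoints (x : edge e) : exists v w, e v w /\ val x = [set v; w].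
Proof.
by have := valP x; rewrite inE => /existsP[v /existsP[w /andP[vw /eqP ->]]]; exists v, w.
Qed.

Lemma in_M_congr (sg tau : spin_config q V) (x : edge e) :
  (forall v, v \in val x -> sg v = tau v) -> (x \in M e sg) = (x \in M e tau).
Proof.
move=> h; rewrite !inE; congr (~~ _).
apply: eq_existsb => v; case: (boolP (v \in val x)) => //= vx.
apply: eq_existsb => w; case: (boolP (w \in val x)) => //= wx.
by rewrite !h.
Qed.

Definition incident S : {set edge e} :=
  [set x : edge e | [exists v in S, v \in val x]].

Lemma incidentP S (x : edge e) :
  reflect (exists2 v, v \in S & v \in val x) (x \in incident S).
Proof. by rewrite inE; apply: exists_inP. Qed.

Lemma incident0 : incident set0 = set0.
Proof. by apply/setP => x; rewrite [RHS]inE; apply/incidentP => -[v]; rewrite inE. Qed.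

Lemma incidentS S S' : S \subset S' -> incident S \subset incident S'.
Proof.
move=> /subsetP SS'; apply/subsetP => x /incidentP[v vS vx].
by apply/incidentP; exists v => //; apply: SS'.
Qed.

Lemma incidentU1 v S : incident (v |: S) = incident [set v] :|: incident S.
Proof.
apply/eqP; rewrite eqEsubset subUset !incidentS ?subsetUl ?subsetUr//= andbT.
apply/subsetP => x /incidentP[w]; rewrite !inE => /orP[wv|wS] wx; apply/orP; [left|right].
  by apply/exists_inP; exists w; rewrite // inE.
by apply/exists_inP; exists w.
Qed.

Lemma card_incident1 v : symmetric e -> (#|incident [set v]| <= max_degree e)%N.
Proof.
move=> e_sym; apply: leq_trans (leq_bigmax v).
rewrite -(card_imset (mem (incident [set v])) val_inj)/=.
apply: leq_trans (leq_imset_card (fun w => [set v; w]) _).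
apply: subset_leq_card; apply/subsetP => y /imsetP[x /incidentP[u] ].
rewrite inE => /eqP -> vx ->.
suff: val x \in [set [set v; w] | w in [set w | e v w]] by [].
move: vx; have [a [b [ab ->] ] ] := edge_endpoints x.
rewrite !inE => /orP[|] /eqP ->.
  by apply/imsetP; exists b; rewrite // inE.
by apply/imsetP; exists a; [rewrite inE e_sym|rewrite setUC].
Qed.

(** Hidden spins read [None] and hidden edges read closed, so all choices of [U] and [W] share one
    codomain. *)
Definition view U W s : {ffun V -> option 'I_q} * {set edge e} :=
  ([ffun v => if v \in U then Some (s.1 v) else None], s.2 :&: W).

Lemma viewP U W s t :
  (view U W s = view U W t) <->
  (forall v, v \in U -> s.1 v = t.1 v) /\
  (forall x, x \in W -> (x \in s.2) = (x \in t.2)).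
Proof.
split => [[/ffunP h1 /setP h2]|[h1 h2]].
  split=> [v vU|x xW]; first by have := h1 v; rewrite !ffunE vU => -[].
  by have := h2 x; rewrite !inE xW !andbT.
congr pair; first by apply/ffunP => v; rewrite !ffunE; case: ifP => // /h1 ->.
by apply/setP => x; rewrite !inE; case: (boolP (x \in W)) => [/h2 ->//|]; rewrite !andbF.
Qed.

Lemma view_refines U U' W W' : U' \subset U -> W' \subset W ->
  refines (view U W) (view U' W').
Proof.
move=> /subsetP UU /subsetP WW s t /viewP[h1 h2]; apply/viewP.
by split=> [v /UU|x /WW]; [apply: h1|apply: h2].
Qed.

Definition glue S s t : T :=
  ([ffun v => if v \in S then t.1 v else s.1 v],
   [set x | if x \in incident S then x \in t.2 else x \in s.2]).

Lemma glueK S s t : glue S (glue S s t) (glue S t s) = s.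
Proof.
case: s t => [sg A] [tau B]; congr pair.
  by apply/ffunP => v; rewrite !ffunE/=; case: (v \in S).
by apply/setP => x; rewrite !in_set; case: [exists v in S, _].
Qed.

(** Exchanging the [S]-parts of a pair is an involution preserving the product weight of pairs that
    agree on [E]. The first view is the richer one off [S] and the second on [S], so the exchange
    carries the two views to their union and intersection. *)
Lemma mass_view_glue (E : {set V}) (P : T -> R) S U1 U2 W1 W2 :
  (forall s t, (forall v, v \in E -> s.1 v = t.1 v) ->
    P (glue S s t) * P (glue S t s) = P s * P t) ->
  E \subset U1 -> E \subset U2 ->
  U2 :\: S \subset U1 -> U1 :&: S \subset U2 ->
  W2 :\: incident S \subset W1 -> W1 :&: incident S \subset W2 ->
  forall x, mass P (view U1 W1) x * mass P (view U2 W2) x =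
    mass P (view (U1 :|: U2) (W1 :|: W2)) x * mass P (view (U1 :&: U2) (W1 :&: W2)) x.
Proof.
move=> Pglue /subsetP EU1 /subsetP EU2 /subsetP U21 /subsetP U12 /subsetP W21 /subsetP W12 x.
rewrite /mass !big_distrlr/= !pair_big/=.
pose sw (st : T * T) := (glue S st.1 st.2, glue S st.2 st.1).
have swK : involutive sw by case=> s t; rewrite /sw/= !glueK.
rewrite (reindex_inj (inv_inj swK))/=; apply: eq_big => [[s t]|[s t]]/=.
  apply/andP/andP => -[/eqP/viewP[h1 k1] /eqP/viewP[h2 k2] ]; split; apply/eqP/viewP; split.
  - move=> v vU; case: (boolP (v \in S)) => vS.
      have vU2 : v \in U2 by move: vU; rewrite inE => /orP[vU|//]; apply: U12; rewrite inE vU.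
      by have := h2 v vU2; rewrite ffunE vS.
    have vU1 : v \in U1 by move: vU; rewrite inE => /orP[//|vU]; apply: U21; rewrite inE vS.
    by have := h1 v vU1; rewrite ffunE (negbTE vS).
  - move=> y yW; case: (boolP (y \in incident S)) => yS.
      have yW2 : y \in W2 by move: yW; rewrite inE => /orP[yW|//]; apply: W12; rewrite in_setI yW.
      by have := k2 y yW2; rewrite inE yS.
    have yW1 : y \in W1 by move: yW; rewrite inE => /orP[//|yW]; apply: W21; rewrite in_setD yS.
    by have := k1 y yW1; rewrite inE (negbTE yS).
  - move=> v /setIP[vU1 vU2]; case: (boolP (v \in S)) => vS.
      by have := h1 v vU1; rewrite ffunE vS.
    by have := h2 v vU2; rewrite ffunE (negbTE vS).
  - move=> y /setIP[yW1 yW2]; case: (boolP (y \in incident S)) => yS.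
      by have := k1 y yW1; rewrite inE yS.
    by have := k2 y yW2; rewrite inE (negbTE yS).
  - move=> v vU1; rewrite ffunE; case: (boolP (v \in S)) => vS.
      by apply: h2; rewrite inE vU1 U12// inE vU1.
    by apply: h1; rewrite inE vU1.
  - move=> y yW1; rewrite inE; case: (boolP (y \in incident S)) => yS.
      by apply: k2; rewrite in_setI yW1 W12// in_setI yW1.
    by apply: k1; rewrite in_setU yW1.
  - move=> v vU2; rewrite ffunE; case: (boolP (v \in S)) => vS.
      by apply: h1; rewrite inE vU2 orbT.
    by apply: h2; rewrite inE vU2 U21// inE vS.
  - move=> y yW2; rewrite inE; case: (boolP (y \in incident S)) => yS.
      by apply: k1; rewrite in_setU yW2 orbT.
    by apply: k2; rewrite in_setI yW2 W21// in_setD yS.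
move=> /andP[/eqP/viewP[h1 _] /eqP/viewP[h2 _] ]; apply: Pglue => v vE.
have := h1 _ (EU1 _ vE); have := h2 _ (EU2 _ vE).
by rewrite !ffunE; case: ifP => _ -> ->.
Qed.

Section Weights.
Variable p : R.

(** The indicator of [A \subset M] is distributed over the open edges, making the weight a product
    over single edges. *)
Definition edge_weight s (x : edge e) : R :=
  if x \in s.2 then p * (x \in M e s.1)%:R else 1 - p.

Definition weight s : R := \prod_x edge_weight s x.

Lemma weightE s :
  p ^+ #|s.2| * (1 - p) ^+ (#|edge e| - #|s.2|) * (s.2 \subset M e s.1)%:R = weight s.
Proof.
rewrite /weight (bigID (mem s.2))/=.
rewrite (eq_bigr (fun x => p * (x \in M e s.1)%:R)); last first.
  by move=> x xA; rewrite /edge_weight xA.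
rewrite [X in _ = _ * X](eq_bigr (fun=> 1 - p)); last first.
  by move=> x /negbTE xA; rewrite /edge_weight xA.
have -> : (#|edge e| - #|s.2| = #|~: s.2|)%N by rewrite [RHS]cardsCs setCK.
rewrite big_split/= -!prodr_const mulrAC; congr (_ * _ * _); last first.
  by apply: eq_bigl => x; rewrite inE.
case: (boolP (_ \subset _)) => [/subsetP AM|].
  by rewrite big1// => x /AM ->.
case/subsetPn => x xA xM; rewrite (bigD1 x)//= (negbTE xM) mul0r//.
Qed.

(** Summing over open and closed, an edge contributes [p + (1 - p) = 1] if monochromatic and [1 - p]
    otherwise. *)
Lemma sum_weight (sg : spin_config q V) :
  \sum_A weight (sg, A) = (1 - p) ^+ #|D e sg|.
Proof.
rewrite /weight /edge_weight/= -(bigA_distr _ _ (fun x => p * (x \in M e sg)%:R) (fun=> 1 - p)).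
rewrite -prodr_const [RHS]big_mkcond; apply: eq_bigr => x _.
rewrite in_setC; case: (x \in D e sg) => /=; first by rewrite mulr0 add0r.
by rewrite mulr1 addrC subrK.
Qed.

Hypothesis p01 : 0 <= p <= 1.

Lemma edge_weight_ge0 s x : 0 <= edge_weight s x.
Proof.
by case/andP: p01 => p0 p1; rewrite /edge_weight; case: ifP; rewrite ?mulr_ge0 ?subr_ge0.
Qed.

Lemma edge_weight_le1 s x : edge_weight s x <= 1.
Proof.
case/andP: p01 => p0 p1; rewrite /edge_weight; case: ifP => _; last lra.
by case: (x \in _); rewrite ?mulr1 ?mulr0.
Qed.

Lemma weight_ge0 s : 0 <= weight s.
Proof. by apply: prodr_ge0 => x _; apply: edge_weight_ge0. Qed.

End Weights.

Section Bipartite.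
Variables (E O : {set V}).
Hypothesis bip : bipartition e E O.

Lemma edge_neighbor_in_E (x : edge e) u v :
  u \in val x -> v \in val x -> u \in O -> v = u \/ v \in E.
Proof.
case: bip => /setP EO EOdisj eEO.
have nO w : w \in O -> w \notin E.
  by move=> wO; apply/negP => /(disjointFr EOdisj); rewrite wO.
have oE w : w \notin O -> w \in E.
  by move=> wO; have := EO w; rewrite !inE (negbTE wO) orbF.
have [a [b [ab ->] ] ] := edge_endpoints x; have abE := eEO _ _ ab.
rewrite !inE => /orP[|] /eqP -> /orP[|] /eqP -> uO; try by left.
  by right; apply: oE; rewrite -abE nO.
by right; rewrite abE.
Qed.

Lemma incident_O : incident O = [set: edge e].
Proof.
case: bip => /setP EO EOdisj eEO; apply/setP => x; rewrite [RHS]inE.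
have [a [b [ab xE] ] ] := edge_endpoints x; apply/incidentP.
have := EO a; rewrite !inE => /orP[aE|aO].
  by exists b; rewrite ?xE ?inE ?eqxx ?orbT// -(eEO _ _ ab).
by exists a; rewrite ?xE ?inE ?eqxx.
Qed.

Lemma edge_weight_glue (p : R) S s t x : S \subset O ->
  (forall v, v \in E -> s.1 v = t.1 v) ->
  edge_weight p (glue S s t) x = edge_weight p (if x \in incident S then t else s) x.
Proof.
move=> /subsetP SO st; rewrite /edge_weight.
have -> : (x \in (glue S s t).2) = (x \in (if x \in incident S then t else s).2).
  by rewrite inE; case: ifP.
case: ifP => // _; congr (_ * (nat_of_bool _)%:R); apply: in_M_congr => v vx.
rewrite ffunE; case: ifP => vS; case: ifP => // xS.
  by move/incidentP: xS => []; exists v.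
case/incidentP: xS => u uS ux.
by case: (edge_neighbor_in_E ux vx (SO _ uS)) => [vu|/st//]; rewrite vu uS in vS.
Qed.

(* Every edge meeting S joins S to E, so given the spins on E the parts of the
   configuration on S and off S are independent. *)
Lemma weight_glue (p : R) S s t : S \subset O ->
  (forall v, v \in E -> s.1 v = t.1 v) ->
  weight p (glue S s t) * weight p (glue S t s) = weight p s * weight p t.
Proof.
move=> SO st; rewrite /weight -!big_split; apply: eq_bigr => x _ /=.
rewrite !edge_weight_glue//; last by move=> v /st.
by case: ifP => _//; rewrite mulrC.
Qed.

End Bipartite.
End JointModel.

(** * Resetting a spin and closing the edges at its vertex *)

Section Clear.
Variables (R : realType) (q : nat) (V : finType) (e : rel V).
Local Notation T := (joint_config q e).

Definition clear (v : V) (k : 'I_q) (s : T) : T :=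
  ([ffun u => if u == v then k else s.1 u], s.2 :\: incident e [set v]).

(** Each edge at [v] had weight at most 1 and now has weight [1 - p]; the other edges do not see
    [v]. *)
Lemma weight_clear (p : R) n v k s : 0 <= p <= 1 ->
  (#|incident e [set v]| <= n)%N ->
  (1 - p) ^+ n * weight p s <= weight p (clear v k s).
Proof.
move=> p01 dn; have /andP[p0 p1] := p01.
have r01 : 0 <= 1 - p <= 1 by apply/andP; split; lra.
apply: (@le_trans _ _ ((1 - p) ^+ #|incident e [set v]| * weight p s)).
  by rewrite ler_wpM2r ?weight_ge0// ler_wiXn2l//; case/andP: r01.
rewrite -prodr_const /weight big_mkcond -big_split/=; apply: ler_prod => x _.
have ew := @edge_weight_ge0 R q V e p p01.
case: (boolP (x \in incident e [set v])) => xv.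
  rewrite mulr_ge0 ?subr_ge0//= [leRHS]/edge_weight in_setD xv/=.
  by rewrite ler_piMr ?subr_ge0 ?edge_weight_le1.
rewrite mul1r ew/= /edge_weight in_setD xv/=.
have -> // : (x \in M e (clear v k s).1) = (x \in M e s.1).
apply: in_M_congr => u ux; rewrite ffunE; case: eqP => // uv.
by case/incidentP: xv; exists v; rewrite ?inE// -uv.
Qed.

(** A preimage is recovered from its spin at [v] and the states of the edges at [v]. *)
Lemma card_clear_fiber v k (s : T) :
  (#|[set t | clear v k t == s]| <= q * 2 ^ #|incident e [set v]|)%N.
Proof.
pose g (t : T) := (t.1 v, t.2 :&: incident e [set v]).
rewrite -(card_in_imset (f := g)); last first.
  move=> t t'; rewrite !inE => /eqP <- /eqP [/ffunP h /setP k'] [hv /setP kv].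
  case: t t' h k' hv kv => [sg A] [tau B]/= h k' hv kv; congr pair.
    apply/ffunP => u; have := h u; rewrite !ffunE; case: eqP => // -> _.
    by rewrite hv.
  apply/setP => x; have := k' x; have := kv x; rewrite !in_setI !in_setD.
  by case: (x \in incident _ _) => /=; rewrite ?andbT.
rewrite [X in (_ <= X * _)%N](_ : q = #|[set: 'I_q]|); last by rewrite cardsT card_ord.
rewrite -card_powerset -cardsX.
apply: subset_leq_card; apply/subsetP => _ /imsetP[t _ ->].
by rewrite !inE/= subsetIr.
Qed.

End Clear.

(** The arithmetic of adding a vertex: [hz] bounds the smaller block (primed letters), [ha] the new
    vertex, and the supermodular inequalities [hb] and [hg] make the sum telescope. *)
Lemma tensor_step (R : realType) (c z a a' b b' x g g' y : R) : 0 <= c ->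
  b + a' <= x + b' -> g + a' <= y + g' ->
  a' - z <= c * ((a' - b') + (a' - g')) -> a - a' <= c * ((a - x) + (a - y)) ->
  a - z <= c * ((a - b) + (a - g)).
Proof.
move=> c0 hb hg hz ha; have := ler_wpM2l c0 hb; have := ler_wpM2l c0 hg.
by rewrite !mulrDr; lra.
Qed.

(** * Tensorization over the vertices of [O] *)

Section EdwardsSokal.
Variables (R : realType) (q : nat) (V : finType) (e : rel V) (p : R).
Hypotheses (q0 : (0 < q)%N) (p01 : 0 <= p < 1).
Local Notation T := (joint_config q e).
Local Notation nu := (edwards_sokal q e p).

Let p01' : 0 <= p <= 1. Proof. by case/andP: p01 => -> /ltW. Qed.
Let r0 : 0 < 1 - p. Proof. by case/andP: p01; rewrite subr_gt0. Qed.

Lemma sum_weight_gt0 : 0 < \sum_(s : T) weight p s.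
Proof.
pose s0 : T := ([ffun=> Ordinal q0], set0).
rewrite (bigD1 s0)//=; apply: ltr_wpDr.
  by apply: sumr_ge0 => s _; apply: weight_ge0.
by apply: prodr_gt0 => x _; rewrite /edge_weight in_set0.
Qed.

Lemma edwards_sokalE s : nu s = weight p s / \sum_(t : T) weight p t.
Proof.
rewrite /edwards_sokal /normalize weightE; congr (_ / _).
by apply: eq_bigr => t _; rewrite weightE.
Qed.

Lemma edwards_sokal_ge0 s : 0 <= nu s.
Proof.
rewrite edwards_sokalE; apply: divr_ge0; first exact: weight_ge0.
exact/ltW/sum_weight_gt0.
Qed.

Lemma sum_edwards_sokal : \sum_s nu s = 1.
Proof.
under eq_bigr do rewrite edwards_sokalE.
by rewrite -mulr_suml divff// gt_eqF// sum_weight_gt0.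
Qed.

(** Clearing with the spin [x.1 v] sends the class of [x] for [view U W] into its class with [v]
    also seen and no open edge at [v]. The weight drops by at most [(1 - p) ^+ n], and fibers have
    at most [q * 2 ^ n] points. *)
Lemma mass_clear n v U (W : {set edge e}) x :
  (#|incident e [set v]| <= n)%N -> [disjoint W & incident e [set v]] ->
  (1 - p) ^+ n / (q * 2 ^ n)%:R * mass nu (view U W) x <=
  mass (fun s => nu s * (s.2 :&: incident e [set v] == set0)%:R)
    (view (v |: U) W) x.
Proof.
move=> dn Wv; set N := fun s : T => s.2 :&: incident e [set v] == set0.
have K0 : 0 < (q * 2 ^ n)%:R :> R by rewrite ltr0n muln_gt0 q0 expn_gt0.
rewrite mulrAC ler_pdivrMr// {1}/mass mulr_sumr.
apply: (@le_trans _ _ (\sum_(s | view U W s == view U W x) nu (clear v (x.1 v) s))).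
  apply: ler_sum => s _; rewrite !edwards_sokalE mulrA.
  by rewrite ler_wpM2r ?weight_clear// invr_ge0 ltW ?sum_weight_gt0.
rewrite (partition_big (clear v (x.1 v))
  (fun t => (view (v |: U) W t == view (v |: U) W x) && N t)); last first.
  move=> s /eqP/viewP[h1 h2]; apply/andP; split.
    apply/eqP/viewP; split => [u|y yW].
      by rewrite !inE ffunE; case: eqP => [->//|_ /= uU]; apply: h1.
    by rewrite in_setD (disjointFr Wv yW) h2.
  by rewrite /N /clear/= setIDAC setDIl setDv setI0.
rewrite [leRHS]mulr_suml big_mkcondr/=; apply: ler_sum => t _.
rewrite -/(N t); case: (N t); last by rewrite mulr0 mul0r.
rewrite mulr1 (eq_bigr (fun=> nu t)) => [|s /andP[_ /eqP -> //]].
rewrite sumr_const -[leLHS]mulr_natr ler_wpM2l ?edwards_sokal_ge0// ler_nat.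
apply: (@leq_trans #|[set s | clear v (x.1 v) s == t]|).
  by apply: subset_leq_card; apply/subsetP => s; rewrite !inE => /andP[].
apply: leq_trans (card_clear_fiber _ _ _) _.
by rewrite leq_mul2l leq_pexp2l ?orbT.
Qed.

Section RelativeEntropy.
Variable F : T -> R.
Hypothesis F0 : forall s, 0 <= F s.
Hypothesis nuF : forall s, nu s = 0 -> F s = 0.
Local Notation ent U W := (rent nu F (view U W)).
Local Notation delta n := ((1 - p) ^+ n / (q * 2 ^ n)%:R).

(** [rent_two_block] with the spin at [v] against the edges at [v], localized to the event that
    these edges are all closed, where seeing them adds nothing. *)
Lemma rent_vertex n v U (W : {set edge e}) :
  (#|incident e [set v]| <= n)%N -> [disjoint W & incident e [set v]] ->
  ent (v |: U) (incident e [set v] :|: W) - ent U W <= (1 + 8 / delta n ^+ 2) *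
    ((ent (v |: U) (incident e [set v] :|: W) - ent (v |: U) W) +
     (ent (v |: U) (incident e [set v] :|: W) - ent U (incident e [set v] :|: W))).
Proof.
move=> dn Wv.
apply: (rent_two_block edwards_sokal_ge0 F0 nuF
  (N := fun s : T => s.2 :&: incident e [set v] == set0)).
- by rewrite divr_gt0 ?exprn_gt0// ltr0n muln_gt0 q0 expn_gt0.
- by apply: view_refines; rewrite ?subsetUr.
- by apply: view_refines; rewrite ?subsetUr.
- by apply: view_refines; rewrite ?subsetUr.
- by apply: view_refines; rewrite ?subsetUr.
- move=> s t /viewP[_ h]; congr (_ == _); apply/setP => x; rewrite !in_setI.
  by case: (boolP (x \in incident e [set v])) => xv; rewrite ?andbF// h// in_setU xv.
- move=> s t /eqP/setP sN /eqP/setP tN /viewP[h1 h2]; apply/viewP; split=> // x.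
  rewrite in_setU => /orP[xv|/h2//].
  by have := sN x; have := tN x; rewrite !in_setI xv !in_set0 !andbT => -> ->.
- by move=> x; apply: mass_clear.
Qed.

Variables (E O : {set V}).
Hypothesis bip : bipartition e E O.

Lemma edwards_sokal_glue (S : {set V}) (s t : T) : S \subset O ->
  (forall v, v \in E -> s.1 v = t.1 v) ->
  nu (glue S s t) * nu (glue S t s) = nu s * nu t.
Proof.
by move=> SO st; rewrite !edwards_sokalE mulrACA (weight_glue bip)// mulrACA.
Qed.

Lemma rent_view_supermodular (S U1 U2 : {set V}) (W1 W2 : {set edge e}) : S \subset O ->
  E \subset U1 -> E \subset U2 ->
  U2 :\: S \subset U1 -> U1 :&: S \subset U2 ->
  W2 :\: incident e S \subset W1 -> W1 :&: incident e S \subset W2 ->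
  ent U1 W1 + ent U2 W2 <= ent (U1 :|: U2) (W1 :|: W2) + ent (U1 :&: U2) (W1 :&: W2).
Proof.
move=> SO EU1 EU2 U21 U12 W21 W12.
apply: (rent_supermodular edwards_sokal_ge0 F0 nuF).
- by apply: view_refines; rewrite ?subsetIl.
- by apply: view_refines; rewrite ?subsetIr.
- by apply: view_refines; rewrite ?subsetUl.
- by apply: view_refines; rewrite ?subsetUr.
- move=> s t /viewP[h1 k1] /viewP[h2 k2]; apply/viewP; split.
    by move=> v /setUP[/h1|/h2].
  by move=> x /setUP[/k1|/k2].
- apply: (mass_view_glue (E := E) (S := S)) => // s t st.
  exact: edwards_sokal_glue.
Qed.

Lemma disjoint_incident v (S : {set V}) : v \in O -> v \notin S -> S \subset O ->
  [disjoint incident e S & incident e [set v]].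
Proof.
move=> vO vS /subsetP SO; rewrite disjoint_subset; apply/subsetP => x xS.
apply/negP => /incidentP[w]; rewrite inE => /eqP -> vx.
case/incidentP: xS => u uS ux.
have [uv|uE] := edge_neighbor_in_E bip vx ux vO; first by rewrite -uv uS in vS.
case: bip => _ /disjointFr/(_ uE); by rewrite SO.
Qed.

(** Induction on the size of [S]: a vertex [v] is removed, and [rent_vertex] is applied with the
    rest of the block already seen. *)
Lemma rent_tensor n :
  (forall v, #|incident e [set v]| <= n)%N ->
  forall S : {set V}, S \subset O ->
  ent (E :|: S) (incident e S) - ent E set0 <= (1 + 8 / delta n ^+ 2) *
    ((ent (E :|: S) (incident e S) - ent (E :|: S) set0) +
     (ent (E :|: S) (incident e S) - ent E (incident e S))).
Proof.
move=> dn S; have [m] := ubnP #|S|; elim: m S => // m IH S Sm SO.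
have [->|[v vS]] := set_0Vmem S.
  by rewrite incident0 setU0 !subrr addr0 mulr0.
pose S' := S :\ v; have vS' : v \notin S' by rewrite !inE eqxx.
have S'O : S' \subset O by apply: subset_trans SO; apply: subsetDl.
have vO : v \in O by apply: (subsetP SO).
have S'm : (#|S'| < m)%N by move: Sm; rewrite (cardsD1 v) vS.
have := IH _ S'm S'O.
have := @rent_vertex n v (E :|: S') (incident e S') (dn v) (disjoint_incident vO vS' S'O).
have eS : v |: (E :|: S') = E :|: S by rewrite setUCA setD1K.
have eI : incident e [set v] :|: incident e S' = incident e S.
  by rewrite -incidentU1 setD1K.
rewrite eS eI.
(* Given the spins on [E :|: S'], the spin at [v] is independent of the edges at [S']. *)
have h1 := @rent_view_supermodular S' (E :|: S) (E :|: S') set0 (incident e S') S'O.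
(* Given the spins on [E] and the edges at [S'], the edges at [v] are independent of the spins on
   [S']. *)
have h2 := @rent_view_supermodular S' E (E :|: S') (incident e S) (incident e S') S'O.
have S'S : S' \subset S by apply: subsetDl.
have f1 : (E :|: S') :\: S' \subset E by rewrite subDset setUC.
have iS'S := incidentS e S'S.
move: h1; rewrite set0U set0I.
rewrite -setUIr (setIidPr S'S) -setUUr (setUidPl S'S) => h1.
move: h2; rewrite (setUidPl iS'S) (setIidPr iS'S) setUA setUid (setIidPl (subsetUl _ _)) => h2.
have {}h1 : ent (E :|: S) set0 + ent (E :|: S') (incident e S') <=
    ent (E :|: S) (incident e S') + ent (E :|: S') set0.
  apply: h1; rewrite ?subsetUl ?set0I ?setDv ?sub0set//.
    exact: subset_trans f1 (subsetUl _ _).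
  exact: subset_trans (subsetIr _ _) (subsetUr _ _).
have {}h2 : ent E (incident e S) + ent (E :|: S') (incident e S') <=
    ent (E :|: S') (incident e S) + ent E (incident e S').
  apply: h2; rewrite ?subsetUl ?setDv ?sub0set ?subsetIr//.
  exact: subset_trans (subsetIl _ _) (subsetUl _ _).
set c := 1 + 8 / _.
have c0 : 0 <= c by rewrite addr_ge0 ?divr_ge0 ?sqr_ge0.
move=> hv hI; exact: tensor_step c0 h1 h2 hI hv.
Qed.

End RelativeEntropy.
End EdwardsSokal.

Lemma eq_rent (R : realType) (T : finType) (P P' F F' : T -> R) (K : eqType)
    (X : T -> K) : P =1 P' -> F =1 F' -> rent P F X = rent P' F' X.
Proof.
move=> PP' FF'; apply: eq_bigr => x _; rewrite FF'; congr (_ * ln (_ / _)).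
  by apply: eq_bigr => y _; rewrite FF'.
by apply: eq_bigr => y _; rewrite PP'.
Qed.

(** * The bound for one side of the bipartition *)

Section SpinBlock.
Variables (R : realType) (q : nat) (V : finType) (e : rel V) (p : R).
Hypotheses (q0 : (0 < q)%N) (p01 : 0 <= p < 1).
Local Notation T := (joint_config q e).
Local Notation nu := (edwards_sokal q e p).

(** The case [S = O] of [rent_tensor], where [E :|: O] is every vertex and [incident e O] every
    edge. *)
Lemma rent_spin_block (F : T -> R) (E O : {set V}) n :
  (forall s, 0 <= F s) -> (forall s, nu s = 0 -> F s = 0) ->
  bipartition e E O ->
  (forall v, #|incident e [set v]| <= n)%N ->
  rent nu F fst - rent nu F (restrict E \o fst) <=
    (1 + 8 / ((1 - p) ^+ n / (q * 2 ^ n)%:R) ^+ 2) *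
    ((rent nu F id - rent nu F fst) + (rent nu F id - rent nu F snd)).
Proof.
move=> F0 nuF bip dn.
have nu0 := edwards_sokal_ge0 (e := e) q0 p01.
have -> : rent nu F id = rent nu F (view setT setT).
  apply: rent_ext => [s t /= -> //|[sg A] [tau B] /viewP[/= h1 h2] ].
  by congr pair; [apply/ffunP => v|apply/setP => x]; [apply: h1|apply: h2]; rewrite in_setT.
have -> : rent nu F fst = rent nu F (view setT set0).
  apply: rent_ext => [s t st|s t /viewP[h _] ].
    by apply/viewP; split => [v _|x]; rewrite ?st// inE.
  by apply/ffunP => v; apply: h; rewrite in_setT.
have -> : rent nu F (restrict E \o fst) = rent nu F (view E set0).
  apply: rent_ext => [s t /ffunP st|s t /viewP[h _] ].
    apply/viewP; split => [v vE|x]; last by rewrite inE.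
    by have := st (exist _ v vE); rewrite !ffunE.
  by apply/ffunP => v; rewrite !ffunE; apply: h; apply: valP.
have tens := rent_tensor q0 p01 F0 nuF bip dn (subxx O).
case: (bip) => EO _ _; rewrite EO (incident_O bip) in tens.
have le_TE : rent nu F (view E set0) <= rent nu F (view setT setT).
  by apply: rent_le => //; apply: view_refines; rewrite ?subsetT.
have le_Tv : rent nu F (view setT set0) <= rent nu F (view setT setT).
  by apply: rent_le => //; apply: view_refines; rewrite ?subsetT.
(* The tensorized bound conditions on [A] together with the spins on [E]; forgetting those spins
   only weakens it. *)
have le_snd : rent nu F snd <= rent nu F (view E setT).
  apply: rent_le => // s t /viewP[_ h]; by apply/setP => x; apply: h; rewrite in_setT.
apply: (@le_trans _ _ (rent nu F (view setT setT) - rent nu F (view E set0))).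
  by rewrite lerD2r.
apply: le_trans tens _; apply: ler_wpM2l; first by rewrite addr_ge0 ?divr_ge0 ?sqr_ge0.
by rewrite lerD2l lerB.
Qed.

End SpinBlock.

(** * The spin marginal and the final combination *)

Lemma potts_marginal (R : realType) (q : nat) (V : finType) (e : rel V) (beta : R) sg :
  (0 < q)%N -> 0 < beta ->
  \sum_A edwards_sokal q e (1 - expR (- beta)) (sg, A) = potts q e beta sg.
Proof.
move=> q0 b0; set p := 1 - _.
have wE tau : \sum_A weight (e := e) p (tau, A) = expR (- (beta * #|D (q := q) e tau|%:R)).
  by rewrite sum_weight /p subKr -mulNr mulrC expRM_natl.
under eq_bigr do rewrite edwards_sokalE.
rewrite -mulr_suml wE /potts /normalize; congr (_ / _).
rewrite -(eq_bigr _ (fun tau _ => wE tau)) pair_bigA.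
by apply: eq_bigr => -[].
Qed.

(** Here [a], [s], [m], [r1], [r2], [r] stand for the relative entropies of the full configuration,
    the spins, the edges, the spins on [E], those on [O], and a constant. The absolute value covers
    a [C] of either sign. *)
Lemma factorization_arith (R : realType) (C c a s m r1 r2 r : R) : 0 <= c ->
  s - r <= C * ((s - r1) + (s - r2)) ->
  s - r1 <= c * ((a - s) + (a - m)) -> s - r2 <= c * ((a - s) + (a - m)) ->
  r1 <= s -> r2 <= s -> s <= a -> m <= a ->
  a - r <= (1 + `|C| * (2 * c)) * ((a - s) + (a - m)).
Proof.
move=> c0 h h1 h2 r1s r2s sa ma.
have le1 : C * ((s - r1) + (s - r2)) <= `|C| * ((s - r1) + (s - r2)).
  by apply: ler_wpM2r; [lra|exact: ler_norm].
have le2 : `|C| * ((s - r1) + (s - r2)) <= `|C| * (2 * (c * ((a - s) + (a - m)))).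
  by apply: ler_wpM2l; [exact: normr_ge0|lra].
by rewrite mulrDl mul1r -[`|C| * _ * _]mulrA -[2 * c * _]mulrA; lra.
Qed.

Theorem lemma1p7 (R : realType) (q : nat) (beta : R) (Delta : nat) (C : R)
    (hq : (2 <= q)%N) (hbeta : 0 < beta) :
  exists C' : R,
    forall (V : finType) (e : rel V) (E O : {set V}),
      simple_graph e ->
      bipartition e E O ->
      (max_degree e <= Delta)%N ->
      even_odd_factorization (potts q e beta) E O C ->
      spin_edge_factorization (edwards_sokal q e (1 - expR (- beta))) C'.
Proof.
set p := 1 - expR (- beta).
(* The single-vertex constant at degree [Delta]; as [1 - p] is [expR (- beta)], it depends on [q],
   [beta] and [Delta] only. *)
pose c := 1 + 8 / ((1 - p) ^+ Delta / (q * 2 ^ Delta)%:R) ^+ 2.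
exists (1 + `|C| * (2 * c)) => V e E O [e_sym e_irr] bip deg eo f f0.
have q0 : (0 < q)%N by apply: ltnW.
have r0 : 0 < expR (- beta) by apply: expR_gt0.
have p01 : 0 <= p < 1.
  rewrite /p subr_ge0 gtrBl r0 andbT -[leRHS]expR0 ler_expR; lra.
have dn v : (#|incident e [set v]| <= Delta)%N.
  exact: leq_trans (card_incident1 v e_sym) deg.
set nu := edwards_sokal q e p.
have nu0 : forall s, 0 <= nu s := edwards_sokal_ge0 (e := e) q0 p01.
pose F s := nu s * f s.
have F0 s : 0 <= F s by rewrite mulr_ge0.
have nuF s : nu s = 0 -> F s = 0 by rewrite /F => ->; rewrite mul0r.
(* The bipartition is symmetric, so the block bound also holds with [O] fixed. *)
have bip' : bipartition e O E.
  case: bip => EO dEO eEO; split; rewrite 1?setUC 1?disjoint_sym// => v w vw.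
  by have := eEO _ _ _; rewrite e_sym in vw => /(_ _ _ vw) ->.
have hE := rent_spin_block q0 p01 F0 nuF bip dn.
have hO := rent_spin_block q0 p01 F0 nuF bip' dn.
pose mu := potts q e beta.
have muE sg : \sum_A nu (sg, A) = mu sg by apply: potts_marginal.
have mu_gt0 sg : 0 < mu sg.
  rewrite /mu /potts /normalize divr_gt0 ?expR_gt0// (bigD1 sg)//=.
  by rewrite ltr_pwDl ?expR_gt0// sumr_ge0// => tau _; rewrite ltW ?expR_gt0.
have sum_mu : \sum_sg mu sg = 1.
  rewrite -(eq_bigr _ (fun sg _ => muE sg)) pair_bigA -(sum_edwards_sokal e q0 p01).
  by apply: eq_bigr => -[].
(* The conditional mean of [f] given the spins, to which the even/odd factorization is applied. *)
pose g sg := (\sum_A F (sg, A)) / mu sg.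
have g0 sg : 0 <= g sg by rewrite divr_ge0 ?sumr_ge0 ?ltW.
have rentE (K : eqType) (X : spin_config q V -> K) :
    rent mu (fun sg => mu sg * g sg) X = rent nu F (X \o fst).
  rewrite -rent_marginal; apply: eq_rent => sg; first by rewrite muE.
  by rewrite /g mulrCA divff ?mulr1// gt_eqF.
have := eo g g0.
rewrite (EntE _ g0) ?mean_cond_EntE//; try by move=> ?; apply: ltW.
rewrite !rentE EntE ?mean_cond_EntE ?sum_edwards_sokal//.
move=> spins; apply: (factorization_arith _ spins hE hO).
- by rewrite addr_ge0 ?divr_ge0 ?sqr_ge0.
- by apply: rent_le => // s t /= ->.
- by apply: rent_le => // s t /= ->.
- by apply: rent_le => // s t ->.
- by apply: rent_le => // s t ->.
Qed.
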